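(* Let $m,\ell,q$ be non-negative integers, put $i=q-m$, and suppose $i\ge 2$ and $\ell\ge q+2i-1$. Let $a,b$ be complex numbers, and let $F(x)$ be the formal power series determined by $$F(x)=\frac{x^m}{1-ax^q-bx^\ell F(x)}.$$ Then for all integers $n\ge 0$, \begin{align*} H_{n(\ell+m)+m+i}(F)&=(-1)^{(n+1)\binom{m+1}{2}+n\binom{\ell-2i+1}{2}+\binom{i-1}{2}-n(i+3)}\,b^{n^2(\ell+m)+n(2i+m-1)}\,[(n+1)a]^{i-1},\\ H_{(n+1)(\ell+m)-i+1}(F)&=(-1)^{(n+1)\left[\binom{\ell-2i+1}{2}+\binom{m+1}{2}\right]+\binom{i-1}{2}-n(i+3)}\,b^{(n+1)(n\ell+nm+\ell-2i+1)}\,[(n+1)a]^{i-1},\\ H_{(n+1)(\ell+m)}(F)&=(-1)^{(n+1)\left[\binom{\ell-2i+1}{2}+\binom{m+1}{2}\right]-n(i+3)+i-1}\,b^{(n+1)(n\ell+nm+\ell-1)},\\ H_{n(\ell+m)+m+1}(F)&=(-1)^{n\binom{\ell-2i+1}{2}+(n+1)\binom{m+1}{2}-n(i+3)}\,b^{n(n+1)(\ell+m)-n(\ell-1)}, \end{align*} and $H_N(F)=0$ for every positive integer $N$ that is not of one of the forms $n(\ell+m)+m+i$, $(n+1)(\ell+m)-i+1$, $(n+1)(\ell+m)$, $n(\ell+m)+m+1$ with $n\ge 0$.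
   Context: For a formal power series $A(x)=\sum_{n\ge 0}a_nx^n$, the Hankel determinant is $H_N(A)=\det(a_{i+j})_{0\le i,j\le N-1}$ for $N\ge 1$, and $H_0(A)=1$ by convention. Powers use the convention $0^0=1$. *)

(* Defs.v *)
From mathcomp Require Import all_boot all_order all_algebra.
From mathcomp Require Export reals complex.

Set Implicit Arguments.
Unset Strict Implicit.
Unset Printing Implicit Defensive.

Import GRing.Theory.
Local Open Scope ring_scope.

(* The value at n is the coefficient of x^n; two series are equal when their
   coefficients are, i.e. equality of series is written with =1. *)
Definition fps (K : fieldType) := nat -> K.

Section FormalPowerSeries.
Variable K : fieldType.
Implicit Types A B D : fps K.

Definition fps_Xn (k : nat) : fps K := fun n => (n == k)%:R.

Definition fps_sub A B : fps K := fun n => A n - B n.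

Definition fps_scale (c : K) A : fps K := fun n => c * A n.

Definition fps_mul A B : fps K := fun n => \sum_(k < n.+1) A k * B (n - k)%N.

(* The coefficients 0 .. n of 1 / D, by the usual recurrence; meaningful when
   D 0 != 0, see fps_mulV below. *)
Fixpoint fps_inv_seq D (n : nat) : seq K :=
  if n is n'.+1 then
    let s := fps_inv_seq D n' in
    rcons s (- (D 0)^-1 * \sum_(k < n) D k.+1 * s`_(n' - k))
  else [:: (D 0)^-1].

Definition fps_inv D : fps K := fun n => (fps_inv_seq D n)`_n.

Definition fps_div A D : fps K := fps_mul A (fps_inv D).

Lemma size_fps_inv_seq D n : size (fps_inv_seq D n) = n.+1.
Proof. by elim: n => //= n IHn; rewrite size_rcons IHn. Qed.

Lemma nth_fps_inv_seq D n k :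
  (k <= n)%N -> (fps_inv_seq D n)`_k = fps_inv D k.
Proof.
elim: n => [|n IHn]; first by rewrite leqn0 => /eqP ->.
rewrite leq_eqVlt => /predU1P[-> //|lt_kn].
by rewrite /= nth_rcons size_fps_inv_seq lt_kn IHn.
Qed.

Lemma fps_invS D n :
  fps_inv D n.+1 = - (D 0)^-1 * \sum_(k < n.+1) D k.+1 * fps_inv D (n - k)%N.
Proof.
rewrite {1}/fps_inv /= nth_rcons size_fps_inv_seq ltnn eqxx.
by congr (_ * _); apply: eq_bigr => k _; rewrite nth_fps_inv_seq ?leq_subr.
Qed.

Lemma fps_mulV D : D 0 != 0 -> fps_mul D (fps_inv D) =1 fps_Xn 0.
Proof.
move=> D0 [|n]; rewrite /fps_mul big_ord_recl /=.
  by rewrite big_ord0 addr0 /fps_Xn /fps_inv /= divff.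
rewrite subn0 fps_invS mulrA mulrN divff // mulN1r.
rewrite (eq_bigr (fun k : 'I_n.+1 => D k.+1 * fps_inv D (n - k)%N)) //.
by rewrite addNr.
Qed.

(* For N = 0 this is the determinant of the empty matrix, which is 1. *)
Definition hankel A (N : nat) : K := \det (\matrix_(i < N, j < N) A (i + j)%N).

End FormalPowerSeries.

Declare Scope fps_scope.
Delimit Scope fps_scope with fps.
Bind Scope fps_scope with fps.
Notation "''X^' k" := (fps_Xn _ k) : fps_scope.
Notation "1" := (fps_Xn _ 0) : fps_scope.
Notation "A - B" := (fps_sub A B) : fps_scope.
Notation "c *: A" := (fps_scale c A) : fps_scope.
Notation "A * B" := (fps_mul A B) : fps_scope.
Notation "A / B" := (fps_div A B) : fps_scope.

(* Main.v *)
From HB Require Import structures.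
Require Import Defs.
From mathcomp Require Import all_boot all_order all_algebra.
From mathcomp Require Import boolp reals complex.
From mathcomp Require Import ring zify.

Set Implicit Arguments.
Unset Strict Implicit.
Unset Printing Implicit Defensive.

Import GRing.Theory.
Local Open Scope ring_scope.

(** The Hankel determinants of a series are read off its continued fraction.
If W A = c x^d with W(0) = 1, multiply the Hankel matrix of A on the left by
the lower triangular Toeplitz matrix L of W and on the right by its transpose.
This changes no determinant, and the product is block diagonal: an
antitriangular block of size d + 1 with c on the antidiagonal, and c times the
Hankel matrix of G, where -G is W with its coefficients up to x^(d+1) removed
and the rest shifted down (toeplitz_hankelE).  Hence
  H_(d+1+M)(A) = (-1)^C(d+1,2) c^(d+1+M) H_M(G),
and H_N(A) = 0 for 0 < N <= d (hankel_continued_fraction, hankel_eq0).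

For a scalar al let S(al) = x^m / (1 - al x^q - b x^l F), so that F = S(a).
Four such steps, of sizes m + 1, i - 1, l - 2i + 1 and i - 1, lead for al <> 0
from S(al) through
  tail1 = al x^(i-2) + b x^(l-m-2) F,
  tail2 = c x^(l-q-i) F / (1 + c x^(l-q) F)     with c = b / al,
  tail3 = -c x^(i-2) (1 - al x^i F),
  tail4 = -al F / (1 - al x^i F)
to tail4 = -al S(al + a).  The bound on l is used in the third step: the
denominator of tail2 contains -a x^q, and q <= l - 2i + 1 makes this term
disappear from tail3.  The powers of al and of c combine to powers of b, so
  H_(l+m+M)(S(al)) = (sign) b^(2M+l-1) H_M(S(al + a))
has no denominator (hankel_ser_period).  For al = 0 it holds because two steps,
of sizes m + 1 and l - 1, lead from S(0) to b F = b S(a).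

Iterating n times turns al = a into (n + 1) a, which is where the factor
[(n + 1) a]^(i-1) comes from, and reduces N to its remainder r modulo l + m.
For r < l + m the determinant H_r(S(al)) vanishes unless r is one of the
block boundaries 0, m + 1, m + i, l + m - i + 1, where it is a monomial in al
and b up to sign. *)

(** * The ring of formal power series *)

Section FpsRing.
Variable K : fieldType.
Implicit Types A B D : fps K.

HB.instance Definition _ := gen_eqMixin (fps K).
HB.instance Definition _ := gen_choiceMixin (fps K).

Definition fps_add A B : fps K := fun n => A n + B n.
Definition fps_opp A : fps K := fun n => - A n.
Definition fps_zero : fps K := fun _ => 0.

Fact fps_addA : associative fps_add.
Proof. by move=> A B D; apply/funext => n; rewrite /fps_add addrA. Qed.
Fact fps_addC : commutative fps_add.
Proof. by move=> A B; apply/funext => n; rewrite /fps_add addrC. Qed.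
Fact fps_add0 : left_id fps_zero fps_add.
Proof. by move=> A; apply/funext => n; rewrite /fps_add add0r. Qed.
Fact fps_addN : left_inverse fps_zero fps_opp fps_add.
Proof. by move=> A; apply/funext => n; rewrite /fps_add addNr. Qed.

HB.instance Definition _ :=
  GRing.isZmodule.Build (fps K) fps_addA fps_addC fps_add0 fps_addN.

(** Associativity and commutativity of the Cauchy product are inherited from
polynomials: each coefficient involves finitely many others. *)
Definition fps_trunc n A : {poly K} := \poly_(k < n.+1) A k.

Lemma fps_mul_poly n A B (p r : {poly K}) :
    (forall k, (k <= n)%N -> p`_k = A k) ->
    (forall k, (k <= n)%N -> r`_k = B k) ->
  forall k, (k <= n)%N -> (p * r)`_k = fps_mul A B k.
Proof.
move=> pA rB k le_kn; rewrite coefM; apply: eq_bigr => j _.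
by have lt_jk := ltn_ord j; rewrite pA ?rB //; lia.
Qed.

Lemma coef_fps_trunc n A k : (k <= n)%N -> (fps_trunc n A)`_k = A k.
Proof. by move=> le_kn; rewrite coef_poly ltnS le_kn. Qed.

Fact fps_mulA : associative (@fps_mul K).
Proof.
move=> A B D; apply/funext => n.
have tr E := @coef_fps_trunc n E.
have trM E E' := fps_mul_poly (tr E) (tr E').
rewrite -(fps_mul_poly (tr A) (trM B D) (leqnn n)) mulrA.
exact: (fps_mul_poly (trM A B) (tr D) (leqnn n)).
Qed.

Fact fps_mulC : commutative (@fps_mul K).
Proof.
move=> A B; apply/funext => n.
have tr E := @coef_fps_trunc n E.
by rewrite -!(fps_mul_poly (tr _) (tr _) (leqnn n)) mulrC.
Qed.

Fact fps_mul1 : left_id (fps_Xn K 0) (@fps_mul K).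
Proof.
move=> A; apply/funext => n; rewrite /fps_mul /fps_Xn big_ord_recl mul1r subn0.
by rewrite big1 ?addr0 // => k _; rewrite mul0r.
Qed.

Fact fps_mulDl : left_distributive (@fps_mul K) fps_add.
Proof.
move=> A B D; apply/funext => n; rewrite /fps_mul /fps_add -big_split.
by apply: eq_bigr => k _; rewrite mulrDl.
Qed.

Fact fps_one_neq0 : fps_Xn K 0 != 0 :> fps K.
Proof.
by apply/eqP => /(congr1 (fun A : fps K => A 0%N)) /eqP; rewrite oner_eq0.
Qed.

HB.instance Definition _ := GRing.Zmodule_isComNzRing.Build (fps K)
  fps_mulA fps_mulC fps_mul1 fps_mulDl fps_one_neq0.

Lemma fpsDE A B n : (A + B : fps K)%R n = A n + B n. Proof. by []. Qed.
Lemma fpsNE A n : (- A : fps K)%R n = - A n. Proof. by []. Qed.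
Lemma fps1E n : (1%R : fps K) n = (n == 0%N)%:R. Proof. by []. Qed.
Lemma fpsME A B n : (A * B : fps K)%R n = \sum_(k < n.+1) A k * B (n - k)%N.
Proof. by []. Qed.

Definition mon (c : K) k : fps K := fps_scale c (fps_Xn K k).

Lemma monE c k n : mon c k n = c * (n == k)%:R. Proof. by []. Qed.

Lemma monME c k A n :
  (mon c k * A)%R n = if (k <= n)%N then c * A (n - k)%N else 0.
Proof.
rewrite fpsME; case: leqP => [le_kn | lt_nk].
  have lt_kn1 : (k < n.+1)%N by [].
  rewrite (bigD1 (Ordinal lt_kn1)) //= monE eqxx mulr1 big1 ?addr0 //.
  move=> s neq_sk; rewrite monE -val_eqE /= in neq_sk *.
  by rewrite (negbTE neq_sk) mulr0 mul0r.
rewrite big1 // => s _; rewrite monE; case: eqP => [eq_sk | _].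
  by have := ltn_ord s; lia.
by rewrite mulr0 mul0r.
Qed.

Lemma monM c k c' k' : (mon c k * mon c' k')%R = mon (c * c') (k + k').
Proof.
apply/funext => n; rewrite monME !monE.
case: leqP => [le_kn | lt_nk].
  have -> : (n - k == k')%N = (n == k + k')%N by lia.
  by rewrite mulrA.
have /negPf -> : (n != k + k')%N by lia.
by rewrite mulr0.
Qed.

Lemma monD c c' k : (mon c k + mon c' k)%R = mon (c + c') k.
Proof. by apply/funext => n; rewrite fpsDE !monE mulrDl. Qed.

Lemma monN c k : mon (- c) k = (- mon c k)%R.
Proof. by apply/funext => n; rewrite fpsNE !monE mulNr. Qed.

Lemma mon1 : mon 1%R 0 = 1%R.
Proof. by apply/funext => n; rewrite monE mul1r. Qed.

Lemma mon0 k : mon 0%R k = 0%R.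
Proof. by apply/funext => n; rewrite monE mul0r. Qed.

Lemma fps_mul_inv D : D 0%N != 0 -> (D * fps_inv D)%R = 1%R.
Proof. by move=> D0; apply/funext => n; exact: (fps_mulV D0). Qed.

Lemma fps_mulI D A B : D 0%N != 0 -> (D * A = D * B)%R -> A = B.
Proof.
move=> D0 eqDA; rewrite -[A]mul1r -[B]mul1r -(fps_mul_inv D0).
by rewrite (mulrC D) -!mulrA eqDA.
Qed.

End FpsRing.

(** * One step of the continued fraction *)

Section Hankel.
Variable K : fieldType.
Implicit Types A B W G : fps K.

Lemma hankel0 A : hankel A 0 = 1.
Proof. exact: det_mx00. Qed.

Lemma hankel_scale c A N : hankel (mon c 0 * A)%R N = c ^+ N * hankel A N.
Proof.
rewrite /hankel -detZ; congr (\det _); apply/matrixP => r s.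
by rewrite !mxE monME subn0.
Qed.

(** All coefficients of A below x^d vanish, hence so does the first row. *)
Lemma hankel_eq0 c d A W N : W 0%N = 1 -> (W * A)%R = mon c d ->
  (0 < N <= d)%N -> hankel A N = 0.
Proof.
move=> W0 WA /andP[]; case: N => // N _ lt_Nd.
have A0 k : (k < d)%N -> A k = 0.
  move=> lt_kd; have WU : W 0%N != 0 by rewrite W0 oner_eq0.
  have -> : A = (mon c d * fps_inv W)%R.
    by apply: (fps_mulI WU); rewrite WA mulrCA (fps_mul_inv WU) mulr1.
  by rewrite monME leqNgt lt_kd.
rewrite /hankel (expand_det_row _ ord0) big1 // => s _.
by rewrite mxE A0 ?mul0r // (leq_trans _ lt_Nd) // ltn_ord.
Qed.

(** Expanding along the first row leaves the last entry c with the cofactor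
sign (-1)^(n-1), and these exponents add up to the binomial coefficient. *)
Lemma det_antitriangular n (c : K) (T : 'M[K]_n) :
    (forall r s : 'I_n, (r + s < n.-1)%N -> T r s = 0) ->
    (forall r s : 'I_n, (r + s)%N = n.-1 -> T r s = c) ->
  \det T = (-1) ^+ 'C(n, 2) * c ^+ n.
Proof.
elim: n T => [|n IHn] T T0 Tc; first by rewrite det_mx00 expr0 mulr1.
rewrite (expand_det_row _ ord0) (bigD1 ord_max) //= big1 ?addr0; last first.
  move=> s neq_s; rewrite T0 ?mul0r //= add0n.
  by have := ltn_ord s; rewrite -val_eqE /= in neq_s; lia.
rewrite Tc //= /cofactor IHn /=; first last.
- by move=> r s rs; rewrite !mxE Tc //= /bump; have := ltn_ord s; lia.
- by move=> r s rs; rewrite !mxE T0 //= /bump; have := ltn_ord s; lia.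
by rewrite add0n binS bin1 addnC !exprD exprS; ring.
Qed.

Definition toeplitz W N : 'M[K]_N :=
  \matrix_(r < N, s < N) (if (s <= r)%N then W (r - s)%N else 0).

Lemma det_toeplitz W N : W 0%N = 1 -> \det (toeplitz W N) = 1.
Proof.
move=> W0; rewrite det_trig; last first.
  by apply/is_trig_mxP => r s lt_rs; rewrite mxE leqNgt lt_rs.
by rewrite big1 // => r _; rewrite mxE leqnn subnn.
Qed.

Lemma toeplitz_mulE W N (r : 'I_N) (f : nat -> K) :
  \sum_(p < N) toeplitz W N r p * f p = \sum_(p < r.+1) W (r - p)%N * f p.
Proof.
rewrite [RHS](big_ord_widen N (fun p => W (r - p)%N * f p)) //.
rewrite [RHS]big_mkcond; apply: eq_bigr => p _; rewrite mxE ltnS.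
by case: ifP; rewrite ?mul0r.
Qed.

(** Row r of the product of the first two factors, read as a series B, is the
part of W A from x^r on, minus the contribution W' A of the coefficients of W
beyond r.  Multiplying by W again turns W' A into W' (W A) = c W' x^d, so that
only W itself remains. *)
Lemma toeplitz_hankelE c d A W N (r s : 'I_N) : (W * A)%R = mon c d ->
  (toeplitz W N *m (\matrix_(p < N, p' < N) A (p + p')%N)
     *m (toeplitz W N)^T) r s =
  (if (r <= d <= r + s)%N then c * W (r + s - d)%N else 0)
  - (if (d < s)%N then c * W (r + s - d)%N else 0).
Proof.
move=> WA.
pose B : fps K := fun n => \sum_(p < r.+1) W (r - p)%N * A (p + n)%N.
pose W' : fps K := fun n => if n is n'.+1 then W (r + n)%N else 0.
have -> : (toeplitz W N *m (\matrix_(p < N, p' < N) A (p + p')%N)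
     *m (toeplitz W N)^T) r s = (W * B)%R s.
  rewrite mulrC fpsME mxE.
  transitivity (\sum_(p < N) toeplitz W N s p * B p).
    apply: eq_bigr => p _; rewrite mulrC [X in X * _]mxE; congr (_ * _).
    rewrite mxE -[B p](toeplitz_mulE W r (fun p' => A (p' + p)%N)).
    by apply: eq_bigr => p' _; rewrite [X in _ * X]mxE.
  by rewrite toeplitz_mulE; apply: eq_bigr => p _; rewrite mulrC.
(* Coefficient r + n of W A splits into the terms W_0, ..., W_r, which form
B_n, and the later ones. *)
have BE : B = ((if (r <= d)%N then mon c (d - r) else 0) - W' * A)%R.
  apply/funext => n; rewrite fpsDE fpsNE fpsME big_ord_recl mul0r add0r.
  apply/eqP; rewrite eq_sym subr_eq; apply/eqP.
  transitivity ((W * A)%R (r + n)%N).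
    rewrite WA; case: leqP => [le_rd | lt_dr]; rewrite !monE.
      by have -> : (n == d - r)%N = (r + n == d)%N by lia.
    have /negPf -> : (r + n != d)%N by lia.
    by rewrite mulr0.
  rewrite fpsME -addSn big_split_ord /=; congr (_ + _).
    rewrite (reindex_inj rev_ord_inj); apply: eq_bigr => p _ /=.
    by have := ltn_ord p => lt_pr; congr (W _ * A _); lia.
  apply: eq_bigr => p _; congr (W _ * A _); rewrite /bump /=; lia.
rewrite BE mulrBr fpsDE fpsNE; congr (_ - _).
  case: ifP => le_rd; rewrite ?mulr0 //= mulrC monME.
  have -> : (d - r <= s)%N = (d <= r + s)%N by lia.
  by case: ifP => // le_d; congr (_ * W _); lia.
rewrite mulrCA WA mulrC monME.
case: (ltngtP d s) => // [lt_ds | ->]; last by rewrite subnn mulr0.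
case def_k: (s - d)%N => [|k]; first by lia.
by congr (_ * W _); lia.
Qed.

(** The off-diagonal blocks vanish because the two terms of toeplitz_hankelE
cancel or are both absent there.  Giving G through the coefficients of W lets
one step serve whatever closed form the next series has. *)
Lemma hankel_continued_fraction c d A W G M :
    W 0%N = 1 -> (W * A)%R = mon c d -> (forall k, W (k + d.+2)%N = - G k) ->
  hankel A (d.+1 + M) =
    (-1) ^+ 'C(d.+1, 2) * c ^+ (d.+1 + M) * hankel G M.
Proof.
move=> W0 WA WG; set N := (d.+1 + M)%N.
pose L := toeplitz W N; pose H := \matrix_(p < N, p' < N) A (p + p')%N.
have -> : hankel A N = \det (L *m H *m L^T).
  by rewrite !det_mulmx det_tr det_toeplitz // mul1r mulr1.
pose T : 'M[K]_d.+1 :=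
  \matrix_(r, s) if (d <= r + s)%N then c * W (r + s - d)%N else 0.
have -> : L *m H *m L^T =
    block_mx T 0 0 (c *: \matrix_(r < M, s < M) G (r + s)%N).
  apply/matrixP => r s; rewrite (toeplitz_hankelE _ _ WA).
  case: (split_ordP r) => r' ->; case: (split_ordP s) => s' -> /=;
    rewrite ?(block_mxEul, block_mxEur, block_mxEdl, block_mxEdr) !mxE.
  - have := ltn_ord r'; have := ltn_ord s'; rewrite !ltnS => le_s le_r.
    by rewrite le_r [(d < s')%N]ltnNge le_s subr0.
  - have := ltn_ord r'; rewrite ltnS => le_r; rewrite le_r !ifT ?subrr //; lia.
  - have := ltn_ord s'; rewrite ltnS => le_s.
    by rewrite [(d < s')%N]ltnNge le_s ifF ?subr0 //; lia.
  - rewrite ifF; last by lia.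
    rewrite ifT; last by lia.
    have -> : (d.+1 + r' + (d.+1 + s') - d)%N = (r' + s' + d.+2)%N by lia.
    by rewrite WG sub0r mulrN opprK.
rewrite det_ublock detZ (@det_antitriangular _ c) => [|r s lt_rs|r s eq_rs].
- by rewrite (exprD c) !mulrA.
- by rewrite mxE leqNgt lt_rs.
- by rewrite mxE eq_rs /= leqnn subnn W0 mulr1.
Qed.

End Hankel.

(** * One period of the continued fraction *)

Section Recursion.
Variables (K : fieldType) (m l q i : nat) (a b : K) (F : fps K).
Hypotheses (q_def : q = (m + i)%N) (i_ge2 : (2 <= i)%N).
Hypothesis l_ge : (q + 2 * i - 1 <= l)%N.

Definition den (al : K) : fps K := (1 - mon al q - mon b l * F)%R.

(** F itself is the member al = a.  The family is closed under a full period
of the continued fraction, which moves al to al + a. *)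
Definition ser (al : K) : fps K := (mon 1 m * fps_inv (den al))%R.

Hypothesis F_eq : F = ser a.

Lemma den0 al : den al 0%N = 1.
Proof.
rewrite /den !fpsDE !fpsNE monME monE fps1E eqxx.
have -> : (0 == q)%N = false by lia.
have -> : (l <= 0)%N = false by lia.
by rewrite mulr0 !subr0.
Qed.

Lemma den_neq0 al : den al 0%N != 0.
Proof. by rewrite den0 oner_eq0. Qed.

Lemma den_ser al : (den al * ser al)%R = mon 1 m.
Proof. by rewrite mulrCA (fps_mul_inv (den_neq0 al)) mulr1. Qed.

Lemma den_F : (den a * F)%R = mon 1 m.
Proof. by rewrite F_eq den_ser. Qed.

Definition tail1 al : fps K :=
  (mon al (i - 2) + mon b (l - m - 2) * F)%R.

(** The step has size m + 1 since q >= m + 2 and l >= m + 2: the denominator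
is 1 up to x^(m+1). *)
Lemma hankel_ser_tail1 al M :
  hankel (ser al) (m.+1 + M) = (-1) ^+ 'C(m.+1, 2) * hankel (tail1 al) M.
Proof.
rewrite (hankel_continued_fraction (G := tail1 al) _ (den0 al) (den_ser al)).
  by rewrite expr1n mulr1.
move=> k; rewrite /den /tail1 !fpsDE !fpsNE !monME !monE fps1E.
rewrite addnS /= sub0r -opprD.
congr (- (_ * _ + _)).
  by have -> : ((k + m.+1).+1 == q)%N = (k == i - 2)%N by lia.
have -> : (l <= (k + m.+1).+1)%N = (l - m - 2 <= k)%N by lia.
by case: leqP => // le_k; congr (_ * F _); lia.
Qed.

(** When al = 0 the leading term of tail1 is b x^(l-2), because F starts with
x^m, and the denominator is the one of F: the tail is F again, up to b. *)
Lemma hankel_tail1_0 M :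
  hankel (tail1 0) (l.-1 + M) =
    (-1) ^+ 'C(l.-1, 2) * b ^+ (l.-1 + 2 * M) * hankel F M.
Proof.
have tailE : (den a * tail1 0)%R = mon b (l - 2).
  rewrite /tail1 mon0 add0r mulrCA den_F monM mulr1; congr mon; lia.
have l1 : l.-1 = (l - 2).+1 by lia.
rewrite l1 (hankel_continued_fraction (G := (mon b 0 * F)%R) _ (den0 a) tailE).
  rewrite hankel_scale mulrA; congr (_ * _).
  by rewrite -mulrA -exprD; congr (_ * b ^+ _); lia.
move=> k; rewrite /den /tail1 !fpsDE !fpsNE !monME !monE fps1E.
have -> : (k + (l - 2).+2 == 0)%N = false by lia.
have -> : (k + (l - 2).+2 == q)%N = false by lia.
have -> : (l <= k + (l - 2).+2)%N by lia.
by rewrite mulr0 oppr0 !add0r leq0n; congr (- (_ * F _)); lia.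
Qed.

Lemma hankel_tail1_0_eq0 N : (0 < N <= l - 2)%N -> hankel (tail1 0) N = 0.
Proof.
apply: (hankel_eq0 (c := b) (den0 a)).
by rewrite /tail1 mon0 add0r mulrCA den_F monM mulr1; congr mon; lia.
Qed.

Section NonZero.
Variable al : K.
Hypothesis al_neq0 : al != 0.
Let c := b / al.
Let alc : al * c = b. Proof. by rewrite mulrC divfK. Qed.

(** tail1, ..., tail4 are the series that remain after one, ..., four steps;
each closed form comes from inverting the previous one. *)
Definition den2 : fps K := (1 + mon c (l - q) * F)%R.
Definition tail2 : fps K := (mon c (l - q - i) * F * fps_inv den2)%R.

(** The denominator of tail2 in lowest terms: multiplying F^-1 x^m = den a by
1 + c x^(l-q) F adds c x^(l-i), as m + l - q = l - i. *)
Definition den3 : fps K := (den a + mon c (l - i))%R.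

Definition den4 : fps K := (1 - mon al i * F)%R.
Definition tail3 : fps K := (mon (- c) (i - 2) * den4)%R.
Definition tail4 : fps K := (mon (- al) 0 * (F * fps_inv den4))%R.

Lemma den2_0 : den2 0%N = 1.
Proof.
rewrite /den2 fpsDE monME fps1E eqxx.
have -> : (l - q <= 0)%N = false by lia.
by rewrite addr0.
Qed.

Lemma den2V : (den2 * fps_inv den2)%R = 1%R.
Proof. by apply: fps_mul_inv; rewrite den2_0 oner_eq0. Qed.

Lemma den4_0 : den4 0%N = 1.
Proof.
rewrite /den4 fpsDE fpsNE monME fps1E eqxx.
have -> : (i <= 0)%N = false by lia.
by rewrite subr0.
Qed.

Lemma den4V : (den4 * fps_inv den4)%R = 1%R.
Proof. by apply: fps_mul_inv; rewrite den4_0 oner_eq0. Qed.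

Lemma fps_inv0 (D : fps K) : D 0%N = 1 -> fps_inv D 0%N = 1.
Proof. by move=> D0; rewrite /fps_inv /= D0 invr1. Qed.

Lemma den2V_tail1 : (fps_inv den2 * tail1 al)%R = mon al (i - 2).
Proof.
have -> : tail1 al = (mon al (i - 2) * den2)%R.
  rewrite /tail1 mulrDr mulr1 mulrA monM alc.
  by congr (_ + mon _ _ * _)%R; lia.
by rewrite mulrCA (mulrC _ den2) den2V mulr1.
Qed.

Lemma hankel_tail1_tail2 M :
  hankel (tail1 al) (i.-1 + M) =
    (-1) ^+ 'C(i.-1, 2) * al ^+ (i.-1 + M) * hankel tail2 M.
Proof.
have i1 : i.-1 = (i - 2).+1 by lia.
rewrite i1.
rewrite (hankel_continued_fraction (G := tail2) _ (fps_inv0 den2_0)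
  den2V_tail1) //.
move=> k.
have -> : fps_inv den2 = (1 - mon 1 i * tail2)%R.
  rewrite /tail2 !mulrA monM mul1r -[X in (X - _)%R]den2V.
  have -> : (i + (l - q - i))%N = (l - q)%N by lia.
  by rewrite /den2; ring.
rewrite fpsDE fpsNE monME fps1E.
have -> : (k + (i - 2).+2 == 0)%N = false by lia.
have -> : (i <= k + (i - 2).+2)%N by lia.
by rewrite sub0r mul1r; congr (- tail2 _); lia.
Qed.

Lemma hankel_tail1_eq0 N : (0 < N <= i - 2)%N -> hankel (tail1 al) N = 0.
Proof. exact: (hankel_eq0 (fps_inv0 den2_0) den2V_tail1). Qed.

Lemma den3_0 : den3 0%N = 1.
Proof.
rewrite /den3 fpsDE den0 monE.
have -> : (0 == l - i)%N = false by lia.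
by rewrite mulr0 addr0.
Qed.

Lemma den3_tail2 : (den3 * tail2)%R = mon c (l - 2 * i).
Proof.
have den3F : (den3 * F = mon 1 m * den2)%R.
  rewrite mulrDl den_F mulrDr mulr1 mulrA monM mul1r.
  by congr (_ + mon _ _ * _)%R; lia.
have -> : (den3 * tail2 = mon c (l - q - i) * (den3 * F) * fps_inv den2)%R.
  by rewrite /tail2; ring.
by rewrite den3F mulrA -mulrA den2V mulr1 monM mulr1; congr mon; lia.
Qed.

(** Here q <= l - 2i + 1 is essential: the term -a x^q belongs to the part of
den3 that the step discards. *)
Lemma hankel_tail2_tail3 M :
  hankel tail2 ((l - 2 * i).+1 + M) =
    (-1) ^+ 'C(l - 2 * i + 1, 2) * c ^+ ((l - 2 * i).+1 + M) * hankel tail3 M.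
Proof.
rewrite addn1 (hankel_continued_fraction (G := tail3) _ den3_0 den3_tail2) //.
move=> k.
have -> : tail3 = (mon (- c) (i - 2) + mon b (2 * i - 2) * F)%R.
  rewrite /tail3 /den4 mulrBr mulr1 mulrA monM.
  have -> : - c * al = - b by rewrite mulNr mulrC alc.
  rewrite [X in (_ - X * _)%R]monN [X in (_ - X)%R]mulNr opprK.
  by congr (_ + mon _ _ * _)%R; lia.
rewrite /den3 /den !fpsDE !fpsNE !monME !monE fps1E.
have -> : (k + (l - 2 * i).+2 == 0)%N = false by lia.
have -> : (k + (l - 2 * i).+2 == q)%N = false by lia.
have -> : (k + (l - 2 * i).+2 == l - i)%N = (k == i - 2)%N by lia.
have -> : (l <= k + (l - 2 * i).+2)%N = (2 * i - 2 <= k)%N by lia.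
rewrite mulr0 oppr0 !add0r opprD mulNr opprK addrC; congr (_ - _).
by case: leqP => // le_k; congr (_ * F _); lia.
Qed.

Lemma hankel_tail2_eq0 N : (0 < N <= l - 2 * i)%N -> hankel tail2 N = 0.
Proof. exact: (hankel_eq0 den3_0 den3_tail2). Qed.

Lemma den4V_tail3 : (fps_inv den4 * tail3)%R = mon (- c) (i - 2).
Proof. by rewrite mulrCA (mulrC _ den4) den4V mulr1. Qed.

Lemma hankel_tail3_tail4 M :
  hankel tail3 (i.-1 + M) =
    (-1) ^+ 'C(i.-1, 2) * (- c) ^+ (i.-1 + M) * hankel tail4 M.
Proof.
have i1 : i.-1 = (i - 2).+1 by lia.
rewrite i1.
rewrite (hankel_continued_fraction (G := tail4) _ (fps_inv0 den4_0)
  den4V_tail3) //.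
move=> k.
have -> : fps_inv den4 = (1 - mon 1 i * tail4)%R.
  rewrite /tail4 !mulrA monM mul1r addn0 monN -[X in (X - _)%R]den4V.
  by rewrite /den4; ring.
rewrite fpsDE fpsNE monME fps1E.
have -> : (k + (i - 2).+2 == 0)%N = false by lia.
have -> : (i <= k + (i - 2).+2)%N by lia.
by rewrite sub0r mul1r; congr (- tail4 _); lia.
Qed.

Lemma hankel_tail3_eq0 N : (0 < N <= i - 2)%N -> hankel tail3 N = 0.
Proof. exact: (hankel_eq0 (fps_inv0 den4_0) den4V_tail3). Qed.

(** The period closes: multiplying 1 - al x^i F by
F^-1 x^m = 1 - a x^q - b x^l F subtracts al x^(m+i) = al x^q, that is,
replaces a by al + a. *)
Lemma tail4E : tail4 = (mon (- al) 0 * ser (al + a))%R.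
Proof.
congr (_ * _)%R; apply: (fps_mulI (den_neq0 (al + a))); rewrite den_ser.
have -> : den (al + a) = (den a - mon al q)%R by rewrite /den -monD; ring.
have -> : mon al q = (mon 1 m * mon al i)%R by rewrite monM mul1r q_def.
have -> : ((den a - mon 1 m * mon al i) * (F * fps_inv den4) =
  (den a * F - mon 1 m * (mon al i * F)) * fps_inv den4)%R by ring.
rewrite den_F -[X in (X - _)%R]mulr1 -mulrBr -mulrA.
by rewrite -/den4 den4V mulr1.
Qed.

End NonZero.

(** The two steps of size i - 1 contribute the same binomial sign twice, and
the constants -c and -al of the last two steps contribute (-1)^(i-1+M) and
(-1)^M; this leaves i - 1. *)
Definition period_sign := ('C(m.+1, 2) + 'C(l - 2 * i + 1, 2) + i.-1)%N.

(** Compares the sign of the step of size l - 1, for al = 0, with that of the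
step of size l - 2i + 1, for al <> 0. *)
Lemma odd_bin2_add x k : odd 'C(x + 2 * k, 2) = odd 'C(x, 2) (+) odd k.
Proof.
elim: k => [|k IHk]; first by rewrite muln0 addn0 addbF.
have -> : (x + 2 * k.+1)%N = (x + 2 * k).+2 by lia.
rewrite binS bin1 binS bin1 oddD [odd (_ + (x + _))]oddD IHk /=.
by case: (odd (x + _)); case: (odd k); case: (odd 'C(x, 2)).
Qed.

(** The exponent of al is the total size l - 1 + M left after the first step,
plus M from the last one; the same total results for c, so that only
powers of al c = b occur. *)
Lemma hankel_ser_period al M :
  hankel (ser al) (l + m + M) =
    (-1) ^+ period_sign * b ^+ (2 * M + l.-1) * hankel (ser (al + a)) M.
Proof.
have [-> | al_neq0] := eqVneq al 0.
  have -> : (l + m + M = m.+1 + (l.-1 + M))%N by lia.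
  rewrite hankel_ser_tail1 hankel_tail1_0 add0r -F_eq !mulrA -exprD.
  congr (_ * b ^+ _ * _); last by lia.
  rewrite -signr_odd -[RHS]signr_odd; congr (_ ^+ nat_of_bool _).
  have -> : l.-1 = (l - 2 * i + 1 + 2 * i.-1)%N by lia.
  by rewrite !oddD odd_bin2_add addbA.
have -> : (l + m + M = m.+1 + (i.-1 + ((l - 2 * i).+1 + (i.-1 + M))))%N by lia.
rewrite hankel_ser_tail1 hankel_tail1_tail2 // hankel_tail2_tail3 //.
rewrite hankel_tail3_tail4 // tail4E //.
rewrite hankel_scale.
have : b / al * al = b by rewrite divfK.
move: (b / al) => c b_def.
set H := hankel _ M.
transitivity ((-1) ^+ ('C(m.+1, 2) + 'C(i.-1, 2) + 'C(l - 2 * i + 1, 2)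
    + 'C(i.-1, 2) + (i.-1 + M) + M) * (al ^+ (2 * M + l.-1)
    * c ^+ (2 * M + l.-1)) * H).
  set u := (i.-1 + M)%N; set v := ((l - 2 * i).+1 + u)%N.
  have exp_al : (2 * M + l.-1 = i.-1 + v + M)%N by lia.
  have exp_c : (2 * M + l.-1 = v + u)%N by lia.
  rewrite {1}exp_al exp_c -[- al]mulN1r -[- c]mulN1r !exprMn.
  by rewrite (exprD al _ M) (exprD c) !(exprD (-1)) !mulrA; ring.
rewrite -exprMn [al * c]mulrC b_def; congr (_ * _ * _).
rewrite -signr_odd -[RHS]signr_odd; congr (_ ^+ nat_of_bool _).
rewrite /period_sign.
move: 'C(m.+1, 2) 'C(l - 2 * i + 1, 2) 'C(i.-1, 2) => w y x.
rewrite !oddD.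
by case: (odd w); case: (odd x); case: (odd y); case: (odd i.-1); case: (odd M).
Qed.

(** * Iteration and the first period *)

(** The exponent of b is the sum of 2 M + l - 1 over the M = k (l + m) + r
with k < n. *)
Lemma hankel_ser_iter n r al :
  hankel (ser al) (n * (l + m) + r) =
    (-1) ^+ (n * period_sign)
    * b ^+ (n * n.-1 * (l + m) + 2 * n * r + n * l.-1)
    * hankel (ser (al + n%:R * a)) r.
Proof.
elim: n al => [|n IHn] al.
  by rewrite mul0r addr0 muln0 !mul0n !add0n !expr0 !mul1r.
have -> : (n.+1 * (l + m) + r = l + m + (n * (l + m) + r))%N by lia.
rewrite hankel_ser_period IHn -addrA -{1}[a]mul1r -mulrDl nat1r.
have -> : (n.+1 * n.+1.-1 * (l + m) + 2 * n.+1 * r + n.+1 * l.-1 =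
    2 * (n * (l + m) + r) + l.-1
    + (n * n.-1 * (l + m) + 2 * n * r + n * l.-1))%N.
  by case: (n) => [|k] /=; ring.
by rewrite mulSn !exprD; ring.
Qed.

Lemma hankel_ser_block1 al : hankel (ser al) m.+1 = (-1) ^+ 'C(m.+1, 2).
Proof. by rewrite -[m.+1]addn0 hankel_ser_tail1 hankel0 mulr1 addn0. Qed.

Lemma hankel_ser_block2 al :
  hankel (ser al) (m + i) =
    (-1) ^+ ('C(m.+1, 2) + 'C(i.-1, 2)) * al ^+ i.-1.
Proof.
have -> : (m + i = m.+1 + (i.-1 + 0))%N by lia.
rewrite hankel_ser_tail1 (exprD (-1)) -mulrA; congr (_ * _).
have [-> | al_neq0] := eqVneq al 0.
  rewrite hankel_tail1_0_eq0; last by lia.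
  have -> : i.-1 = (i - 2).+1 by lia.
  by rewrite exprS mul0r mulr0.
by rewrite hankel_tail1_tail2 // hankel0 mulr1 addn0.
Qed.

Lemma hankel_ser_block3 al :
  hankel (ser al) (l + m - i + 1) =
    (-1) ^+ ('C(m.+1, 2) + 'C(i.-1, 2) + 'C(l - 2 * i + 1, 2))
    * al ^+ i.-1 * b ^+ (l - 2 * i + 1).
Proof.
have -> : (l + m - i + 1 = m.+1 + (i.-1 + ((l - 2 * i).+1 + 0)))%N by lia.
rewrite hankel_ser_tail1 -addnA (exprD (-1)) -!mulrA; congr (_ * _).
have [-> | al_neq0] := eqVneq al 0.
  rewrite hankel_tail1_0_eq0; last by lia.
  have -> : i.-1 = (i - 2).+1 by lia.
  by rewrite exprS mul0r mul0r mulr0.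
rewrite hankel_tail1_tail2 // hankel_tail2_tail3 // hankel0 mulr1 !addn0 addn1.
have : b / al * al = b by rewrite divfK.
move: (b / al) => c <-.
by rewrite exprMn (exprD (-1)) (exprD al); ring.
Qed.

(** Between two block boundaries some step meets a nonempty proper leading
minor of its antitriangular block. *)
Lemma hankel_ser_eq0 al r : (0 < r < l + m)%N -> r <> m.+1 -> r <> (m + i)%N ->
  r <> (l + m - i + 1)%N -> hankel (ser al) r = 0.
Proof.
move=> r_bound r1 r2 r3.
have [le_rm | lt_mr] := leqP r m.
  by apply: (hankel_eq0 (den0 al) (den_ser al)); lia.
have [s def_r] : {s | r = (m.+1 + s)%N} by exists (r - m.+1)%N; lia.
rewrite {}def_r in r_bound r1 r2 r3 lt_mr *.
rewrite hankel_ser_tail1.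
have [-> | al_neq0] := eqVneq al 0.
  by rewrite hankel_tail1_0_eq0 ?mulr0 //; lia.
have [le_s | lt_s] := leqP s (i - 2).
  by rewrite hankel_tail1_eq0 ?mulr0 //; lia.
have [t def_s] : {t | s = (i.-1 + t)%N} by exists (s - i.-1)%N; lia.
rewrite {}def_s in r_bound r1 r2 r3 lt_mr lt_s *.
rewrite hankel_tail1_tail2 //.
have [le_t | lt_t] := leqP t (l - 2 * i).
  by rewrite hankel_tail2_eq0 ?mulr0 //; lia.
have [u def_t] : {u | t = ((l - 2 * i).+1 + u)%N}.
  by exists (t - (l - 2 * i).+1)%N; lia.
rewrite {}def_t in r_bound r1 r2 r3 lt_mr lt_s lt_t *.
by rewrite hankel_tail2_tail3 // hankel_tail3_eq0 ?mulr0 //; lia.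
Qed.

End Recursion.

(** * The determinants of F *)

Lemma signz_diff (K : fieldType) (u v w k : nat) :
  (u + v = w + 2 * k)%N -> (-1 : K) ^ (u%:Z - v%:Z) = (-1) ^+ w.
Proof.
move=> eq_uv; rewrite expfzDr ?oppr_eq0 ?oner_eq0 // -exprnN -exprnP.
by rewrite invr_sign -exprD eq_uv exprD exprM sqrrN !expr1n mulr1.
Qed.

Theorem theorem21 (R : realType) (m l q i : nat) (a b : R[i]) (F : fps R[i])
  (hi : i = (q - m)%N) (hi2 : (2 <= i)%N) (hl : (q + 2 * i - 1 <= l)%N)
  (hF : F =1 ('X^m / (1 - a *: 'X^q - b *: ('X^l * F)))%fps) :
  (forall n : nat,
    [/\ hankel F (n * (l + m) + m + i) =
          (-1) ^ ((n.+1 * 'C(m.+1, 2) + n * 'C(l - 2 * i + 1, 2)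
                    + 'C(i - 1, 2))%:Z - (n * (i + 3))%:Z)
          * b ^+ (n ^ 2 * (l + m) + n * (2 * i + m - 1))
          * (n.+1%:R * a) ^+ (i - 1),
        hankel F (n.+1 * (l + m) - i + 1) =
          (-1) ^ ((n.+1 * ('C(l - 2 * i + 1, 2) + 'C(m.+1, 2))
                    + 'C(i - 1, 2))%:Z - (n * (i + 3))%:Z)
          * b ^+ (n.+1 * (n * l + n * m + l - 2 * i + 1))
          * (n.+1%:R * a) ^+ (i - 1),
        hankel F (n.+1 * (l + m)) =
          (-1) ^ ((n.+1 * ('C(l - 2 * i + 1, 2) + 'C(m.+1, 2)))%:Z
                    - (n * (i + 3))%:Z + i%:Z - 1)
          * b ^+ (n.+1 * (n * l + n * m + l - 1))
      & hankel F (n * (l + m) + m + 1) =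
          (-1) ^ ((n * 'C(l - 2 * i + 1, 2) + n.+1 * 'C(m.+1, 2))%:Z
                    - (n * (i + 3))%:Z)
          * b ^+ (n * n.+1 * (l + m) - n * (l - 1))]) /\
  (forall N : nat, (0 < N)%N ->
    (forall n : nat,
      [/\ N <> (n * (l + m) + m + i)%N,
          N <> (n.+1 * (l + m) - i + 1)%N,
          N <> (n.+1 * (l + m))%N
        & N <> (n * (l + m) + m + 1)%N]) ->
    hankel F N = 0).
Proof.
have q_def : q = (m + i)%N by lia.
have F_ser : F = ser m l q b F a.
  have XnE k : fps_Xn R[i] k = mon 1 k.
    by apply/funext => n; rewrite monE mul1r.
  apply/funext => k; rewrite hF /ser /den !XnE mon1.
  congr (fps_mul _ (fps_inv _) _); apply/funext => n.
  rewrite fpsDE fpsNE fpsDE fpsNE /fps_sub /fps_scale.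
  have -> : fps_mul (mon 1 l) F n = (mon 1 l * F)%R n by [].
  by rewrite !monME !monE !mul1r; case: ifP; rewrite ?mulr0.
pose iter n r := hankel_ser_iter q_def hi2 hl F_ser n r a.
have coefE n : a + n%:R * a = n.+1%:R * a by rewrite -{1}[a]mul1r -mulrDl nat1r.
have [j def_i] : {j | i = j.+2} by exists (i - 2)%N; lia.
have [e def_l] : {e | l = (2 * i + e)%N} by exists (l - 2 * i)%N; lia.
have i1 : (i - 1)%N = i.-1 by lia.
(* Modulo 2 the term - n (i + 3) of the four exponents of -1 may be added
instead; it then exceeds the n (i - 1) of the iteration by 4 n = 2 (2 n). *)
split=> [n | N N_gt0 N_neq].
  split.
  - rewrite -addnA F_ser iter (hankel_ser_block2 q_def hi2 hl F_ser) coefE i1.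
    rewrite (@signz_diff _ _ _ (n * period_sign m l i
      + ('C(m.+1, 2) + 'C(i.-1, 2))) (2 * n)); last first.
      by rewrite /period_sign def_i /=; ring.
    have -> : (n ^ 2 * (l + m) + n * (2 * i + m - 1) =
        n * n.-1 * (l + m) + 2 * n * (m + i) + n * l.-1)%N.
      have -> : (2 * i + m - 1 = 2 * j + 3 + m)%N by lia.
      have -> : l.-1 = (2 * j + 3 + e)%N by lia.
      by rewrite def_l def_i; case: (n) => [|k] /=; ring.
    by rewrite (exprD (-1) (n * _)); ring.
  - have -> : (n.+1 * (l + m) - i + 1 = n * (l + m) + (l + m - i + 1))%N by lia.
    rewrite F_ser iter (hankel_ser_block3 q_def hi2 hl F_ser) coefE i1.
    rewrite (@signz_diff _ _ _ (n * period_sign m l i + ('C(m.+1, 2)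
      + 'C(i.-1, 2) + 'C(l - 2 * i + 1, 2))) (2 * n)); last first.
      by rewrite /period_sign def_i /=; ring.
    have -> : (n.+1 * (n * l + n * m + l - 2 * i + 1) =
        n * n.-1 * (l + m) + 2 * n * (l + m - i + 1) + n * l.-1
        + (l - 2 * i + 1))%N.
      have -> : (n * l + n * m + l - 2 * i + 1 = n * l + n * m + e + 1)%N.
        by lia.
      have -> : (l - 2 * i + 1 = e + 1)%N by lia.
      have -> : (l + m - i + 1 = j + e + m + 3)%N by lia.
      have -> : l.-1 = (2 * j + 3 + e)%N by lia.
      by rewrite def_l def_i; case: (n) => [|k] /=; ring.
    by rewrite (exprD (-1) (n * _)) (exprD b _ (l - _ + _)); ring.
  - rewrite -[(n.+1 * (l + m))%N]addn0 F_ser iter hankel0 mulr1.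
    have -> : ((n.+1 * ('C(l - 2 * i + 1, 2) + 'C(m.+1, 2)))%:Z
        - (n * (i + 3))%:Z + i%:Z - 1 =
      (n.+1 * ('C(l - 2 * i + 1, 2) + 'C(m.+1, 2)) + i.-1)%:Z
        - (n * (i + 3))%:Z).
      rewrite PoszD; have -> : i%:Z = i.-1%:Z + 1 by lia.
      by ring.
    rewrite (@signz_diff _ _ _ (n.+1 * period_sign m l i) (2 * n)); last first.
      by rewrite /period_sign def_i /=; ring.
    congr (_ * b ^+ _).
    have -> : (n * l + n * m + l - 1 = n * l + n * m + l.-1)%N by lia.
    by rewrite /=; ring.
  - rewrite -addnA addn1 F_ser iter (hankel_ser_block1 _ _ q_def hi2 hl).
    rewrite (@signz_diff _ _ _ (n * period_sign m l i + 'C(m.+1, 2)) (2 * n));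
      last first.
      by rewrite /period_sign def_i /=; ring.
    have -> : (n * n.+1 * (l + m) - n * (l - 1) =
        n * n.-1 * (l + m) + 2 * n * m.+1 + n * l.-1)%N.
      have -> : (l - 1 = 2 * j + 3 + e)%N by lia.
      have -> : l.-1 = (2 * j + 3 + e)%N by lia.
      apply/eqP; rewrite -(eqn_add2r (n * (2 * j + 3 + e))) subnK; last first.
        by rewrite -mulnA leq_mul2l; apply/orP; right; lia.
      apply/eqP.
      by rewrite def_l def_i; case: (n) => [|k] /=; ring.
    by rewrite (exprD (-1) (n * _)); ring.
have lm_gt0 : (0 < l + m)%N by lia.
have def_N := divn_eq N (l + m).
have lt_r := ltn_pmod N lm_gt0.
move: (N %/ (l + m))%N (N %% (l + m))%N def_N lt_r => n r def_N lt_r.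
have [e1 e2 _ e4] := N_neq n.
(* r = 0 would make N a positive multiple of l + m, the third excluded form. *)
have r_gt0 : (0 < r)%N.
  case: r def_N {lt_r} => // def_N; case: n {e1 e2 e4} def_N => [|n] def_N.
    by lia.
  by have [_ _ e3 _] := N_neq n; lia.
by rewrite def_N F_ser iter (hankel_ser_eq0 q_def hi2 hl F_ser) ?mulr0 //; lia.
Qed.
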